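(* Let $\{q,p;t,h\}$ be the ${\rm P}_{\rm III'}$ Hamiltonian system with parameters $\mathbf v=(0,0)$ and put $T=\tfrac14 t$. Then its canonical variables are related by canonical transformations to those of the following ${\rm P}_{\rm III'}$ Hamiltonian systems in the independent variable $T$; that is, whenever $(q(t),p(t))$ solves the Hamilton equations with $\mathbf v=(0,0)$, each of the following pairs solves the Hamilton equations (in $T$) with the indicated parameters. (S) $\{Q_S,P_S;T,H_S\}$ with $\mathbf v=(0,-1)$: $$Q_S=\frac{i\sqrt t}{2}\,\frac{1}{\sqrt p+\sqrt{p-1}}\;\frac{\tfrac12+q\sqrt p\sqrt{p-1}-i\sqrt t\sqrt{p-1}}{\tfrac12-q\sqrt p\sqrt{p-1}+i\sqrt t\sqrt{p-1}},$$ $$P_S=-\frac{i}{\sqrt t}\left(\sqrt p+\sqrt{p-1}\right)\left[\tfrac12-q\sqrt p\sqrt{p-1}+i\sqrt t\sqrt p\right].$$ (E) $\{Q_E,P_E;T,H_E\}$ with $\mathbf v=(1,0)$: $$Q_E=-\frac{i\sqrt t}{2}\left(\sqrt p+\sqrt{p-1}\right)\left\{1-\frac{1}{\tfrac12+q\sqrt p\sqrt{p-1}-i\sqrt t\sqrt{p-1}}-\frac{1}{\tfrac12+q\sqrt p\sqrt{p-1}+i\sqrt t\sqrt p}\right\},$$ $$P_E=-\frac{i}{\sqrt t}\,\frac{\tfrac12+q\sqrt p\sqrt{p-1}+i\sqrt t\sqrt p}{\sqrt p+\sqrt{p-1}}.$$ (N) $\{Q_N,P_N;T,H_N\}$ with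 $\mathbf v=(0,1)$: $$Q_N=-\frac{i\sqrt t}{2}\,\frac{1}{\sqrt p+\sqrt{p-1}}\;\frac{\tfrac12+q\sqrt p\sqrt{p-1}+i\sqrt t\sqrt p}{\tfrac12-q\sqrt p\sqrt{p-1}-i\sqrt t\sqrt p},$$ $$P_N=\frac{i}{\sqrt t}\,\frac{\tfrac12-q\sqrt p\sqrt{p-1}-i\sqrt t\sqrt p}{\sqrt p-\sqrt{p-1}}.$$
   Context: For parameters $\mathbf v=(v_1,v_2)\in\mathbb C^2$, the ${\rm P}_{\rm III'}$ Hamiltonian system $\{q,p;t,H\}$ has the Hamiltonian $H=H(q,p;t;\mathbf v)$ given by $$tH=q^2p^2-(q^2+v_1q-t)p+\tfrac12(v_1+v_2)q,$$ and Hamilton equations $q'=\partial H/\partial p$, $p'=-\partial H/\partial q$ (with $'=d/dt$), i.e. $$tq'=2q^2p-q^2-v_1q+t,\qquad tp'=-2qp^2+(2q+v_1)p-\tfrac12(v_1+v_2).$$ The same formulas with $(q,p,t)$ replaced by $(Q,P,T)$ and $'=d/dT$ define the system $\{Q,P;T,H\}$. Here $(q(t),p(t))$ are complex analytic functions on a domain of $\mathbb C\setminus\{0\}$ on which analytic branches of $\sqrt t,\sqrt p,\sqrt{p-1}$ are fixed; each of these symbols denotes the same branch throughout all the formulas. The formulas are understood generically: where $t,p,p-1$ and all displayed denominators are nonzero. ''Canonical transformation'' means a transformation carrying the Hamilton equations of one system to the Hamilton equations of the other (the independent variable is also rescaled). *)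

(* Defs.v *)
From mathcomp Require Export all_boot all_order all_algebra.
From mathcomp Require Export all_classical all_reals all_analysis.
From mathcomp Require Export complex.
From mathcomp Require Import ring.

Set Implicit Arguments.
Unset Strict Implicit.
Unset Printing Implicit Defensive.

Import Order.TTheory GRing.Theory Num.Theory.
Import numFieldNormedType.Exports.

Local Open Scope classical_set_scope.
Local Open Scope ring_scope.

(* Typing the complex numbers as a numClosedFieldType gives access to 'i and, *)
(* through numFieldNormedType, to the topology of the modulus; derivable and  *)
(* derive1 at this type are then complex differentiability and d/dz.          *)
Definition Cplx (R : realType) : numClosedFieldType := R[i].

Lemma derive1_quadratic (K : numFieldType) (a b c x : K) :
  derive1 (fun y : K => a * (y * y) + b * y + c) x = 2 * a * x + b.
Proof.
rewrite derive1E.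
rewrite (_ : (fun y => _) = a \*: (id * id : K -> K) + b \*: (id : K -> K) + cst c) //.
rewrite derive_val /GRing.scale /=; ring.
Qed.

Section PIIIprime.
Context {C : numClosedFieldType}.

Definition complex_domain (U : set C) : Prop :=
  [/\ open U, connected U & U !=set0].

(* For C = Cplx R and U open, complex differentiability on U is analyticity. *)
Definition analytic_on (U : set C) (f : C -> C) : Prop :=
  forall z, U z -> derivable f z 1.

Definition analytic_sqrt (U : set C) (f r : C -> C) : Prop :=
  analytic_on U r /\ forall z, U z -> r z ^+ 2 = f z.

Definition hamiltonian (v : C * C) (q p t : C) : C :=
  (q ^+ 2 * p ^+ 2 - (q ^+ 2 + v.1 * q - t) * p + 2^-1 * (v.1 + v.2) * q) / t.

Definition hamilton_solution (v : C * C) (D : set C) (q p : C -> C) : Prop :=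
  forall t, D t ->
  [/\ derivable q t 1, derivable p t 1,
      derive1 q t = derive1 (fun y => hamiltonian v (q t) y t) (p t) &
      derive1 p t = - derive1 (fun x => hamiltonian v x (p t) t) (q t)].

Lemma derive1_hamiltonian_p (v : C * C) (q p t : C) :
  derive1 (fun y => hamiltonian v q y t) p =
  (2 * q ^+ 2 * p - q ^+ 2 - v.1 * q + t) / t.
Proof.
rewrite (_ : (fun y => _) = fun y => q ^+ 2 / t * (y * y) +
  - ((q ^+ 2 + v.1 * q - t) / t) * y + 2^-1 * (v.1 + v.2) * q / t).
  by rewrite derive1_quadratic; ring.
by apply/funext => y; rewrite /hamiltonian; ring.
Qed.

Lemma derive1_hamiltonian_q (v : C * C) (q p t : C) :
  derive1 (fun x => hamiltonian v x p t) q =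
  (2 * q * p ^+ 2 - (2 * q + v.1) * p + 2^-1 * (v.1 + v.2)) / t.
Proof.
rewrite (_ : (fun y => _) = fun x => (p ^+ 2 - p) / t * (x * x) +
  (2^-1 * (v.1 + v.2) - v.1 * p) / t * x + p * t / t).
  by rewrite derive1_quadratic; ring.
by apply/funext => y; rewrite /hamiltonian; ring.
Qed.

Lemma hamilton_solutionE (v : C * C) (D : set C) (q p : C -> C) : ~ D 0 ->
  hamilton_solution v D q p <->
  forall t, D t ->
  [/\ derivable q t 1, derivable p t 1,
      t * derive1 q t = 2 * q t ^+ 2 * p t - q t ^+ 2 - v.1 * q t + t &
      t * derive1 p t = - 2 * q t * p t ^+ 2 + (2 * q t + v.1) * p t
                        - 2^-1 * (v.1 + v.2)].
Proof.
move=> D0; split=> sol t Dt; have [dq dp eq ep] := sol t Dt.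
all: have t0 : t != 0 by apply: contra_notN D0 => /eqP <-.
- split=> //; first by rewrite eq derive1_hamiltonian_p mulrC divfK.
  rewrite ep derive1_hamiltonian_q mulrN mulrC divfK //.
  by ring.
- split=> //; apply: (mulfI t0).
    by rewrite eq derive1_hamiltonian_p [RHS]mulrC divfK.
  rewrite ep derive1_hamiltonian_q mulrN [t * (_ / t)]mulrC divfK //.
  by ring.
Qed.

(* Below s, a, b are the branches of sqrt t, sqrt p, sqrt (p - 1).            *)
(* The sets regular* require every displayed denominator to be nonzero; s and *)
(* a + b, a - b need no condition, since s ^+ 2 = t and                       *)
(* (a + b) * (a - b) = p - (p - 1) = 1.                                       *)
Section transformations.
Variables (q p s a b : C -> C).

Definition QS (t : C) : C :=
  'i * s t / 2 * (1 / (a t + b t)) *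
  ((2^-1 + q t * a t * b t - 'i * s t * b t) /
   (2^-1 - q t * a t * b t + 'i * s t * b t)).

Definition PS (t : C) : C :=
  - ('i / s t) * (a t + b t) * (2^-1 - q t * a t * b t + 'i * s t * a t).

Definition regularS : set C := [set t |
  [/\ t != 0, p t != 0, p t - 1 != 0 &
      2^-1 - q t * a t * b t + 'i * s t * b t != 0]].

Definition QE (t : C) : C :=
  - ('i * s t / 2) * (a t + b t) *
  (1 - 1 / (2^-1 + q t * a t * b t - 'i * s t * b t)
     - 1 / (2^-1 + q t * a t * b t + 'i * s t * a t)).

Definition PE (t : C) : C :=
  - ('i / s t) *
  ((2^-1 + q t * a t * b t + 'i * s t * a t) / (a t + b t)).

Definition regularE : set C := [set t |
  [/\ t != 0, p t != 0, p t - 1 != 0,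
      2^-1 + q t * a t * b t - 'i * s t * b t != 0 &
      2^-1 + q t * a t * b t + 'i * s t * a t != 0]].

Definition QN (t : C) : C :=
  - ('i * s t / 2) * (1 / (a t + b t)) *
  ((2^-1 + q t * a t * b t + 'i * s t * a t) /
   (2^-1 - q t * a t * b t - 'i * s t * a t)).

Definition PN (t : C) : C :=
  'i / s t *
  ((2^-1 - q t * a t * b t - 'i * s t * a t) / (a t - b t)).

Definition regularN : set C := [set t |
  [/\ t != 0, p t != 0, p t - 1 != 0 &
      2^-1 - q t * a t * b t - 'i * s t * a t != 0]].

End transformations.
End PIIIprime.

(* Main.v *)
(* Put x = i sqrt t, w = q sqrt p sqrt (p - 1), a = sqrt p, b = sqrt (p - 1). *)
(* Along a solution with v = (0, 0), these four functions satisfy the closed  *)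
(* rational system                                                            *)
(*   t x' = x / 2,   w' = a b,   t a' = - w b,   t b' = - w a,                *)
(* with t = - x ^ 2 and a ^ 2 - b ^ 2 = 1.  The pairs (Q, P) are rational in  *)
(* (x, w, a, b), since i / sqrt t = - 1 / x, so each Hamilton equation        *)
(* becomes a rational identity modulo these two relations.                    *)

Require Import Defs.
From mathcomp Require Import ring.

Import Order.TTheory GRing.Theory Num.Theory.
Import numFieldNormedType.Exports.

Local Open Scope classical_set_scope.
Local Open Scope ring_scope.

(** Since [a ^ 2 - b ^ 2 = 1], write [a = cosh u], [b = sinh u]. The system for [w, a, b] then says
    [t u' = - w] and [w' = sinh u cosh u], that is [(t u')' = sinh (2 u) / - 2], the sinh form of
    the equation; the target pairs are rational in [x], [w], [exp u = a + b] and its inverse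
    [a - b]. [branch_flow_solution] passes from [(q, p)] to this flow. [south_flow], [east_flow] and
    [north_flow] differentiate each pair along it and check both equations as identities of rational
    functions, and [hamilton_solution_quarter] returns to the variable [T]. *)

Lemma is_derive_addf {K : numFieldType} {f g : K -> K} {x df dg : K} :
  is_derive x 1 f df -> is_derive x 1 g dg ->
  is_derive x 1 (fun y => f y + g y) (df + dg).
Proof. exact: is_deriveD. Qed.

Lemma is_derive_oppf {K : numFieldType} {f : K -> K} {x df : K} :
  is_derive x 1 f df -> is_derive x 1 (fun y => - f y) (- df).
Proof. exact: is_deriveN. Qed.

Lemma is_derive_mulf {K : numFieldType} {f g : K -> K} {x df dg : K} :
  is_derive x 1 f df -> is_derive x 1 g dg ->
  is_derive x 1 (fun y => f y * g y) (f x * dg + g x * df).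
Proof. exact: is_deriveM. Qed.

Lemma is_derive_invf {K : numFieldType} {f : K -> K} {x df : K} :
  f x != 0 -> is_derive x 1 f df ->
  is_derive x 1 (fun y => (f y)^-1) (- (f x) ^- 2 * df).
Proof.
move=> fx0 [dvf <-]; apply: DeriveDef; first exact: derivableV.
exact: deriveV.
Qed.

Lemma is_derive_scale_arg {K : numFieldType} {f : K -> K} {c x df : K} :
  is_derive (c * x) 1 f df -> is_derive x 1 (fun y => f (c * y)) (c * df).
Proof.
move=> [/derivable1_diffP df' <-].
have cM := is_derive_mulf (is_derive_cst c x 1) (is_derive_id x 1).
set g : K -> K := fun y => _ in cM; have [/derivable1_diffP dg vg] := cM.
have dfg : differentiable (f \o g) x by exact: differentiable_comp.
apply: (@DeriveDef _ _ _ _ _ (f \o g)); first exact/derivable1_diffP.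
have dg1 : 'd g x 1 = c by rewrite -deriveE // vg mulr1 mulr0 addr0.
rewrite deriveE // diff_comp //=.
apply: etrans (congr1 _ dg1) _.
rewrite (deriveE _ df') -[X in 'd _ _ X]mulr1.
exact: linearZ.
Qed.

(** The branch is known to be differentiable, so its derivative comes from differentiating
    [r ^ 2 = f]. *)
Lemma is_derive_sqrt {C : numClosedFieldType} {U : set C} {f r : C -> C}
    {x df : C} :
  open U -> analytic_sqrt U f r -> U x -> f x != 0 ->
  is_derive x 1 f df -> is_derive x 1 r (df / (2 * r x)).
Proof.
move=> oU [ar rf] Ux fx0 dfx.
have rx0 : r x != 0 by move: fx0; rewrite -rf // expf_eq0.
have dr := derivableP (ar x Ux).
apply: is_derive_eq (dr) _; have [_ <-] := dfx.
(* As [U] is open, [f] agrees with [r * r] near [x]. *)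
have [_ ->] : is_derive x 1 f (r x * 'D_1 r x + r x * 'D_1 r x).
  apply: near_eq_is_derive (is_derive_mulf _ _) => //.
  by near=> y; rewrite -expr2 rf //; near: y; exact: open_nbhs_nbhs.
by field.
Unshelve. all: by end_near. Qed.

(* The Hamilton equations in T = t / 4, multiplied by T and written in t. *)
Definition solves_quarter {K : numFieldType} (v : K * K) (Q P : K -> K)
    (t : K) : Prop :=
  exists dQ dP, [/\ is_derive t 1 Q dQ, is_derive t 1 P dP,
    t * dQ = 2 * Q t ^+ 2 * P t - Q t ^+ 2 - v.1 * Q t + t / 4 &
    t * dP = - 2 * Q t * P t ^+ 2 + (2 * Q t + v.1) * P t
             - 2^-1 * (v.1 + v.2)].

(** For [t = 4 T], the operators [T d/dT] and [t d/dt] coincide; only the explicit term [T = t / 4]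
    records the rescaling. *)
Lemma hamilton_solution_quarter {C : numClosedFieldType} (v : C * C)
    (D : set C) (Q P : C -> C) : ~ D 0 ->
  (forall t, D t -> solves_quarter v Q P t) ->
  hamilton_solution v [set T | D (4 * T)]
    (fun T => Q (4 * T)) (fun T => P (4 * T)).
Proof.
move=> D0 sol; apply/hamilton_solutionE => [/=|T /= DT]; first by rewrite mulr0.
have [dQ [dP [/is_derive_scale_arg [derQ eQ] /is_derive_scale_arg [derP eP]]]]
  := sol _ DT.
rewrite !derive1E eQ eP !mulrA ![T * 4]mulrC => -> ->.
split; [exact: derQ|exact: derP| |by []].
by congr (_ + _); field.
Qed.

Record branch_flow {K : numFieldType} (x w a b : K -> K) (t : K) : Prop := {
  flow_t0 : t != 0;
  flow_xx : t = - x t ^+ 2;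
  flow_bb : b t ^+ 2 = a t ^+ 2 - 1;
  flow_dx : is_derive t 1 x (x t / (2 * t));
  flow_dw : is_derive t 1 w (a t * b t);
  flow_da : is_derive t 1 a (- w t * b t / t);
  flow_db : is_derive t 1 b (- w t * a t / t) }.

Lemma branch_flow_solution {C : numClosedFieldType} {U : set C}
    {q p s a b : C -> C} {t : C} :
  open U -> analytic_sqrt U (fun t => t) s -> analytic_sqrt U p a ->
  analytic_sqrt U (fun t => p t - 1) b -> ~ U 0 ->
  hamilton_solution (0, 0) U q p ->
  U t -> p t != 0 -> p t - 1 != 0 ->
  branch_flow (fun y => 'i * s y) (fun y => q y * a y * b y) a b t.
Proof.
move=> oU ss sa sb U0 /(hamilton_solutionE _ _ _ U0) sol Ut pt0 pt1.
have t0 : t != 0 by apply: contra_notN U0 => /eqP <-.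
have [/derivableP dq /derivableP dp] := sol t Ut; rewrite !derive1E /=.
set q' := 'D_1 q t; set p' := 'D_1 p t => eq ep.
have ds := is_derive_sqrt oU ss Ut t0 (is_derive_id t 1).
have da := is_derive_sqrt oU sa Ut pt0 dp.
have dp1 : is_derive t 1 (fun y => p y - 1) (p' + 0).
  by apply: is_derive_addf dp _; exact: is_derive_cst.
have db := is_derive_sqrt oU sb Ut pt1 dp1.
have a2 := sa.2 t Ut; have b2 := sb.2 t Ut; have s2 := ss.2 t Ut.
have a0 : a t != 0 by move: pt0; rewrite -a2 expf_eq0.
have b0 : b t != 0 by move: pt1; rewrite -b2 expf_eq0.
have s0 : s t != 0 by apply: contraNneq t0 => s0; rewrite -s2 s0 expr0n.
have {}eq : q' = (2 * q t ^+ 2 * a t ^+ 2 - q t ^+ 2 + t) / t.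
  by apply: (mulfI t0); rewrite eq a2; field.
have {}ep : p' = - 2 * q t * a t ^+ 2 * b t ^+ 2 / t.
  by apply: (mulfI t0); rewrite ep a2 b2; field.
have {}da : is_derive t 1 a (- (q t * a t * b t) * b t / t).
  by apply: is_derive_eq da _; rewrite -/p' ep; field; rewrite t0.
have {}db : is_derive t 1 b (- (q t * a t * b t) * a t / t).
  by apply: is_derive_eq db _; rewrite ep; field; rewrite t0.
split=> //.
- by rewrite exprMn sqrCi s2 mulN1r opprK.
- by rewrite a2 b2.
- apply: is_derive_eq (is_derive_mulf (is_derive_cst 'i t 1) ds) _.
  by rewrite /=; field: s2; rewrite t0.
(* The terms of [w'] quadratic in [q] cancel because [a ^ 2 + b ^ 2 = 2 a ^ 2 - 1], leaving
   [a b]. *)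
apply: is_derive_eq (is_derive_mulf (is_derive_mulf dq da) db) _.
have ab : b t ^+ 2 = a t ^+ 2 - 1 by rewrite a2 b2.
by rewrite -/q' eq; field: ab.
Qed.


Lemma add_branch_neq0 {K : fieldType} {a b : K} :
  b ^+ 2 = a ^+ 2 - 1 -> a + b != 0.
Proof.
move=> bb; have ab1 : (a + b) * (a - b) = 1 by ring: bb.
by apply: contra_eq_neq ab1 => ->; rewrite mul0r eq_sym oner_eq0.
Qed.

Lemma sub_branch_neq0 {K : fieldType} {a b : K} :
  b ^+ 2 = a ^+ 2 - 1 -> a - b != 0.
Proof. by move=> bb; apply: add_branch_neq0; rewrite sqrrN. Qed.

(** The derivative is an existential variable, built by following the syntax of the function;
    [eassumption] supplies the flow equations and the nonvanishing of denominators. *)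
Ltac derive_rational :=
  repeat first
    [ eassumption
    | exact: is_derive_cst
    | notypeclasses refine (is_derive_mulf _ _)
    | notypeclasses refine (is_derive_addf _ _)
    | notypeclasses refine (is_derive_oppf _)
    | notypeclasses refine (is_derive_invf _ _) ].

(** The factor [x / 2] is a square root of [- T], as [T = t / 4] and [t = - x ^ 2]. *)
Lemma south_flow {K : numFieldType} {x w a b : K -> K} {t : K} :
  branch_flow x w a b t ->
  2^-1 - w t + x t * b t != 0 ->
  solves_quarter (0, -1)
    (fun y => x y / 2 * (1 / (a y + b y)) *
      ((2^-1 + w y - x y * b y) / (2^-1 - w y + x y * b y)))
    (fun y => (x y)^-1 * (a y + b y) * (2^-1 - w y + x y * a y)) t.
Proof.
move=> [t0 tx bb dx dw da db] den0.
have x0 : x t != 0 by apply: contraNneq t0 => x0; rewrite tx x0 expr0n oppr0.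
have apb := add_branch_neq0 bb.
eexists; eexists; split; [by derive_rational|by derive_rational| |] => /=.
(* The derivatives are now explicit, so only identities between field elements remain, modulo [bb]
   and [tx]. *)
all: move: (w t) (a t) (b t) (x t) tx bb x0 apb den0
  => W A B X tx bb x0 apb den0.
(* The side conditions of field have their denominators cleared. *)
all: have {}den0 : 1 + - W * 2 + X * B * 2 != 0
  by rewrite (_ : 1 + - W * 2 + X * B * 2 = 2 * (2^-1 - W + X * B))
    ?mulf_neq0 ?pnatr_eq0 //; field.
all: by field: bb tx; rewrite t0 x0 apb den0.
Qed.

Lemma east_flow {K : numFieldType} {x w a b : K -> K} {t : K} :
  branch_flow x w a b t ->
  2^-1 + w t - x t * b t != 0 ->
  2^-1 + w t + x t * a t != 0 ->
  solves_quarter (1, 0)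
    (fun y => - (x y / 2) * (a y + b y) *
      (1 - 1 / (2^-1 + w y - x y * b y) - 1 / (2^-1 + w y + x y * a y)))
    (fun y => (x y)^-1 * ((2^-1 + w y + x y * a y) / (a y + b y))) t.
Proof.
move=> [t0 tx bb dx dw da db] den0 den1.
have x0 : x t != 0 by apply: contraNneq t0 => x0; rewrite tx x0 expr0n oppr0.
have apb := add_branch_neq0 bb.
eexists; eexists; split; [by derive_rational|by derive_rational| |] => /=.
all: move: (w t) (a t) (b t) (x t) tx bb x0 apb den0 den1
  => W A B X tx bb x0 apb den0 den1.
all: have {}den0 : 1 + W * 2 + - (X * B) * 2 != 0
  by rewrite (_ : 1 + W * 2 + - (X * B) * 2 = 2 * (2^-1 + W - X * B))
    ?mulf_neq0 ?pnatr_eq0 //; field.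
all: have {}den1 : 1 + W * 2 + X * A * 2 != 0
  by rewrite (_ : 1 + W * 2 + X * A * 2 = 2 * (2^-1 + W + X * A))
    ?mulf_neq0 ?pnatr_eq0 //; field.
all: by field: bb tx; rewrite t0 x0 apb den0 den1.
Qed.

Lemma north_flow {K : numFieldType} {x w a b : K -> K} {t : K} :
  branch_flow x w a b t ->
  2^-1 - w t - x t * a t != 0 ->
  solves_quarter (0, 1)
    (fun y => - (x y / 2) * (1 / (a y + b y)) *
      ((2^-1 + w y + x y * a y) / (2^-1 - w y - x y * a y)))
    (fun y => - (x y)^-1 * ((2^-1 - w y - x y * a y) / (a y - b y))) t.
Proof.
move=> [t0 tx bb dx dw da db] den0.
have x0 : x t != 0 by apply: contraNneq t0 => x0; rewrite tx x0 expr0n oppr0.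
have apb := add_branch_neq0 bb; have amb := sub_branch_neq0 bb.
eexists; eexists; split; [by derive_rational|by derive_rational| |] => /=.
all: move: (w t) (a t) (b t) (x t) tx bb x0 apb amb den0
  => W A B X tx bb x0 apb amb den0.
all: have {}den0 : 1 + - W * 2 + - (X * A) * 2 != 0
  by rewrite (_ : 1 + - W * 2 + - (X * A) * 2 = 2 * (2^-1 - W - X * A))
    ?mulf_neq0 ?pnatr_eq0 //; field.
all: by field: bb tx; rewrite t0 x0 apb amb den0.
Qed.

(** Turns the prefactor ['i / s] of each [P] into [- 1 / x]; the [Q] formulas already have the shape
    used by the flow lemmas. *)
Lemma i_div {C : numClosedFieldType} (z : C) : 'i / z = - ('i * z)^-1.
Proof. by rewrite invfM invCi mulNr opprK. Qed.

Theorem corollary2 (R : realType) (U : set (Cplx R))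
    (q p s a b : Cplx R -> Cplx R)
    (domU : complex_domain U) (U0 : ~ U 0)
    (sqrt_t : analytic_sqrt U (fun t => t) s)
    (sqrt_p : analytic_sqrt U p a)
    (sqrt_p1 : analytic_sqrt U (fun t => p t - 1) b)
    (sol : hamilton_solution (0, 0) U q p) :
  [/\ hamilton_solution (0, -1) [set T | (U `&` regularS q p s a b) (4 * T)]
        (fun T => QS q s a b (4 * T)) (fun T => PS q s a b (4 * T)),
      hamilton_solution (1, 0) [set T | (U `&` regularE q p s a b) (4 * T)]
        (fun T => QE q s a b (4 * T)) (fun T => PE q s a b (4 * T)) &
      hamilton_solution (0, 1) [set T | (U `&` regularN q p s a b) (4 * T)]
        (fun T => QN q s a b (4 * T)) (fun T => PN q s a b (4 * T))].
Proof.
have [oU _ _] := domU.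
have flow t := branch_flow_solution (t := t) oU sqrt_t sqrt_p sqrt_p1 U0 sol.
split; apply: hamilton_solution_quarter => [[]//|t [Ut]].
- move=> [_ p0 p1 den].
  rewrite (_ : PS q s a b = fun y => ('i * s y)^-1 * (a y + b y) *
    (2^-1 - q y * a y * b y + 'i * s y * a y)); last first.
    by apply/funext => y; rewrite /PS i_div opprK.
  exact: south_flow (flow t Ut p0 p1) den.
- move=> [_ p0 p1 den1 den2].
  rewrite (_ : PE q s a b = fun y => ('i * s y)^-1 *
    ((2^-1 + q y * a y * b y + 'i * s y * a y) / (a y + b y))); last first.
    by apply/funext => y; rewrite /PE i_div opprK.
  exact: east_flow (flow t Ut p0 p1) den1 den2.
- move=> [_ p0 p1 den].
  rewrite (_ : PN q s a b = fun y => - ('i * s y)^-1 *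
    ((2^-1 - q y * a y * b y - 'i * s y * a y) / (a y - b y))); last first.
    by apply/funext => y; rewrite /PN i_div.
  exact: north_flow (flow t Ut p0 p1) den.
Qed.
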